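(* Let $\Omega$ be a disk in $\mathcal{F}$ and for each $n\ge1$ let $f_n:\Omega\to\mathcal{F}$ be a scaling map with scaling ratio $q^{\lambda_n}$, where $(\lambda_n)$ is a strictly increasing sequence of integers. Then $$\dim_{\mathcal H}\{x\in\Omega:([f_n(x)]_0)_{n\ge1}\text{ is not uniformly distributed in }\mathcal{O}/\mathfrak{p}\}=1,$$ and consequently $$\dim_{\mathcal H}\{x\in\Omega:([f_n(x)])_{n\ge1}\text{ is not uniformly distributed in }\mathcal{O}\}=1.$$
   Context: $\mathcal{F}$ is a non-Archimedean local field with valuation ring $\mathcal{O}$, maximal ideal $\mathfrak{p}$, $q=\#\mathcal{O}/\mathfrak{p}$, normalized absolute value $|\cdot|_\mathfrak{p}$, prime element $\pi$. Fix representatives $C\subset\mathcal{O}$ of $\mathcal{O}/\mathfrak{p}$ with $0\in C$; writing $x=\sum_{n\ge v}c_n\pi^n$ ($c_n\in C$), $[x]=\sum_{n\ge0}c_n\pi^n$ and $[x]_0=c_0$ (the $0$-digit). A disk is $D(a,r)=\{x:|x-a|_\mathfrak{p}\le r\}$. A map $f:\Omega\to\mathcal{F}$ is scaling with ratio $q^\lambda$ if $|f(x)-f(y)|_\mathfrak{p}=q^\lambda|x-y|_\mathfrak{p}$ for all $x,y\in\Omega$. A sequence with values in a finite set of $m$ symbols (here $C\cong\mathcal{O}/\mathfrak{p}$, $m=q$) is uniformly distributed if each symbol occurs with asymptotic frequency $1/m$. A sequence $(x_n)\subset\mathcal{O}$ is uniformly distributed in $\mathcal{O}$ if for all $a\in\mathcal{O}$,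 $k\in\mathbb{N}$, $\frac1N\#\{1\le n\le N:x_n\in D(a,q^{-k})\}\to q^{-k}$. Hausdorff dimension is with respect to the metric $|x-y|_\mathfrak{p}$. *)

(* Defs.v *)
From HB Require Import structures.
From mathcomp Require Import all_boot all_order all_algebra.
From mathcomp Require Import all_classical all_reals all_analysis.
Set Implicit Arguments. Unset Strict Implicit. Unset Printing Implicit Defensive.
Import Order.TTheory GRing.Theory Num.Theory numFieldNormedType.Exports.
Local Open Scope classical_set_scope.
Local Open Scope ring_scope.

Section LocalField.
Variables (R : realType) (F : fieldType) (v : F -> int) (q : nat).

Definition absv (x : F) : R := if x == 0 then 0 else (q%:R : R) ^ (- v x).

Definition is_dvaluation : Prop :=
  [/\ (forall x y, x != 0 -> y != 0 -> v (x * y) = v x + v y),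
      (forall x y, x != 0 -> y != 0 -> x + y != 0 -> Num.min (v x) (v y) <= v (x + y))
    & (exists pi, pi != 0 /\ v pi = 1)].

Definition rep_system (C : seq F) : Prop :=
  (forall c, c \in C -> absv c <= 1) /\
  (forall x, absv x <= 1 -> exists! c, c \in C /\ absv (x - c) < 1).

Definition residue_card : Prop :=
  exists C : seq F, rep_system C /\ uniq C /\ size C = q.

Definition complete_absv : Prop :=
  forall u : nat -> F,
    (forall e : R, 0 < e -> exists N, forall m n, (N <= m)%N -> (N <= n)%N ->
        absv (u m - u n) < e) ->
    exists l, forall e : R, 0 < e -> exists N, forall n, (N <= n)%N -> absv (u n - l) < e.

Definition nonarch_local_field : Prop :=
  [/\ (1 < q)%N, is_dvaluation, residue_card & complete_absv].

(* a : nat -> F, m : nat is a digit expansion x = sum_{i>=0} a_i pi^(i-m),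
   digits in C, convergence expressed with finite partial sums *)
Definition is_expansion (C : seq F) (pi : F) (x : F) (a : nat -> F) (m : nat) : Prop :=
  (forall i, a i \in C) /\
  (forall k : nat, absv (x - \sum_(i < k) a i * pi ^ (i%:Z - m%:Z))
                   <= (q%:R : R) ^ (- (k%:Z - m%:Z))).

Definition digit0 (C : seq F) (pi x : F) : F :=
  xget 0 [set c | exists a m, is_expansion C pi x a m /\ a m = c].

(* [x] = sum_{n >= 0} c_n pi^n *)
Definition intpart (C : seq F) (pi x : F) : F :=
  xget 0 [set y | exists a m, is_expansion C pi x a m /\
                    y = x - \sum_(i < m) a i * pi ^ (i%:Z - m%:Z)].

Definition disk (a : F) (r : R) : set F := [set x | absv (x - a) <= r].

Definition scaling_on (Om : set F) (f : F -> F) (lam : int) : Prop :=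
  forall x y, Om x -> Om y -> absv (f x - f y) = (q%:R : R) ^ lam * absv (x - y).

Definition ud_symbols (C : seq F) (s : nat -> F) : Prop :=
  forall c, c \in C ->
    (fun N : nat => (count (fun n => s n == c) (iota 0 N))%:R / (N%:R : R))
      @ \oo --> (q%:R : R)^-1.

Definition ud_O (s : nat -> F) : Prop :=
  forall a, absv a <= 1 -> forall k : nat,
    (fun N : nat => (count (fun n => absv (s n - a) <= (q%:R : R) ^ (- k%:Z)) (iota 0 N))%:R
                     / (N%:R : R))
      @ \oo --> (q%:R : R) ^ (- k%:Z).

Definition ediam (U : set F) : \bar R :=
  ereal_sup [set (absv (x - y))%:E | x in U & y in U].

Definition hausdorff_pre (s d : R) (A : set F) : \bar R :=
  ereal_inf [set (\sum_(0 <= i <oo) ((powR (fine (ediam (U i))) s)%:E))%E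
            | U in [set U : nat -> set F |
                    A `<=` \bigcup_i U i /\ forall i, (ediam (U i) <= d%:E)%E]].

Definition hausdorff_measure (s : R) (A : set F) : \bar R :=
  ereal_sup [set hausdorff_pre s d A | d in [set d : R | 0 < d]].

Definition hausdorff_dim (A : set F) : \bar R :=
  ereal_inf [set s%:E | s in [set s : R | 0 < s /\ hausdorff_measure s A = 0%E]].

End LocalField.

(* Main.v *)
(** The upper bound comes from covering the disk by [q^k] balls of radius
    comparable to [q^-k].  The integral part of [y] and its [0]-digit agree
    modulo the maximal ideal, so uniform distribution of the integral parts
    forces that of the digits, and both lower bounds follow from one.

    Lower bound: fix [s < 1] and a small [e > 0].  Distinct children of a ball
    of radius [q^-(lam n)] have distinct [0]-digits under [f n], so at most one
    child has digit [0].  Give that child the weight [1 - (q-1) e] and its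
    siblings [1 + e]; at levels that are no [lam n] all weights are [1].  For a
    cover of small [s]-dimensional cost, let the potential of a ball [V] be the
    cost of the cover sets inside [V] plus half the relative Haar measure of
    [V].  It is superadditive over children, and the weights of the children
    sum to at least [q], so some child multiplies the potential by at most its
    weight divided by [q].  Descending greedily yields a point [x].  The weights
    are at most [q^(1-s)], so the potential on the path to [x] decays too fast
    for [x] to lie in a cover set; and the Haar part of the potential keeps the
    product of the weights along the path above [1/2].  Because
    [(1 - (q-1) e) (1 + e)^(q-1) < 1], this prevents digit [0] from having
    frequency [1/q]. *)
Require Import Defs.
From HB Require Import structures.
From mathcomp Require Import all_boot all_order all_algebra.
From mathcomp Require Import all_classical all_reals all_analysis.
From mathcomp Require Import zify ring lra.
Import Order.TTheory GRing.Theory Num.Theory numFieldNormedType.Exports.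
Local Open Scope classical_set_scope.
Local Open Scope ring_scope.
Set Implicit Arguments.
Unset Strict Implicit.
Unset Printing Implicit Defensive.

(** * Weighted products and the frequency of a digit *)

(* Taking logarithms, [(Q - 1) ln (1 + e) < (Q - 1) e <= - ln (1 - (Q - 1) e)]. *)
Lemma biased_product_not_uniform (R : realType) (Q e : R) (n0 : nat)
    (p : pred nat) :
  1 < Q -> 0 < e -> (Q - 1) * e < 1 ->
  (forall M, (n0 <= M)%N ->
     2^-1 <= \prod_(n0 <= n < M) (if p n then 1 - (Q - 1) * e else 1 + e)) ->
  ~ ((fun N : nat => (count p (iota 0 N))%:R / (N%:R : R)) @ \oo --> Q^-1).
Proof.
move=> Q1 e0 Qe prodP freq.
pose A := 1 - (Q - 1) * e; pose B := 1 + e; pose x := - ln A; pose y := ln B.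
have A0 : 0 < A by rewrite /A; lra.
have B0 : 0 < B by rewrite /B; lra.
have y0 : 0 < y by rewrite ln_gt0// /B; lra.
have ye : y < e.
  rewrite -[ltRHS]expRK ltr_ln ?posrE ?expR_gt0//.
  by rewrite expR_gt1Dx// gt_eqF.
have xe : (Q - 1) * e <= x.
  by rewrite /x lerNr /A; apply: le_ln1Dx; lra.
have xy : Q * y < x + y.
  have : (Q - 1) * y < (Q - 1) * e by rewrite ltr_pM2l// subr_gt0.
  by rewrite mulrBl mul1r; lra.
have S0 : 0 < x + y by apply: lt_trans xy; rewrite mulr_gt0//; lra.
pose cnt N : R := (count p (iota 0 N))%:R.
(* An index adds [y - (x + y)] to the logarithm when [p] holds and [y] otherwise; the surplus
   [n0%:R * y] and the bound [cnt n0 <= n0] absorb the indices below [n0]. *)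
have ln_prodP k : 0 < \prod_(n0 <= n < n0 + k) (if p n then A else B) /\
    ln (\prod_(n0 <= n < n0 + k) (if p n then A else B)) <=
      (n0 + k)%:R * y - (x + y) * (cnt (n0 + k)%N - n0%:R).
  elim: k => [|k [P0 IH]].
    rewrite addn0 big_geq// ln1 ltr01; split=> //.
    have : cnt n0 <= n0%:R by rewrite ler_nat (leq_trans (count_size _ _))// size_iota.
    rewrite -subr_le0 => c0; rewrite subr_ge0 (@le_trans _ _ 0)//.
      by rewrite pmulr_rle0.
    by rewrite mulr_ge0 ?ler0n ?(ltW y0).
  rewrite addnS big_nat_recr ?leq_addr//=; split.
    by rewrite mulr_gt0//; case: ifP.
  rewrite lnM ?posrE//; last by case: ifP.
  rewrite /cnt -addn1 iotaD count_cat /= add0n addn0 natrD.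
  have lnA : ln A = - x by rewrite opprK.
  move: IH; case: (p _); rewrite ?lnA -/y !natrD -/(cnt _) /= ?mulr1n ?mulr0n.
    by lra.
  by lra.
pose K := (x + y) * n0%:R + ln 2.
have cntP M : (n0 <= M)%N -> (x + y) * cnt M <= M%:R * y + K.
  move=> nM; have [P0 H] := ln_prodP (M - n0)%N; rewrite subnKC// in P0 H.
  have : - ln 2 <= M%:R * y - (x + y) * (cnt M - n0%:R).
    apply: le_trans H; rewrite -lnV ?posrE// ler_ln ?posrE ?invr_gt0//.
    exact: prodP.
  by rewrite /K; lra.
(* Half the gap between [Q^-1] and [y / (x + y)], the largest limiting frequency that [cntP]
   allows. *)
pose g := (Q^-1 - y / (x + y)) / 2.
have g0 : 0 < g.
  by apply: divr_gt0 => //; rewrite subr_gt0 ltr_pdivrMr// ltr_pdivlMl//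
    (lt_trans ltr01).
have K0 : 0 <= K.
  by rewrite addr_ge0 ?mulr_ge0 ?ler0n ?(ltW S0)// ltW// ln_gt0// ltr1n.
have /cvgr_gt/(_ (Q^-1 - g))[|N _ NP] := freq; first by rewrite gtrBl.
pose M := maxn (maxn N n0) (Num.Def.archi_bound (K / ((x + y) * g))).+1.
have nM : (n0 <= M)%N by rewrite /M !leq_max leqnn orbT.
have M0 : 0 < M%:R :> R by rewrite ltr0n /M leq_max orbT.
have := NP M; rewrite /= /M !leq_max leqnn => /(_ isT); rewrite -/M.
apply/negP; rewrite -leNgt ler_pdivrMr//.
have KM : K <= (x + y) * g * M%:R.
  rewrite -ler_pdivrMl ?(mulr_gt0 S0 g0)// mulrC.
  apply: le_trans (ltW (archi_boundP _)) _.
    by rewrite divr_ge0// ltW// (mulr_gt0 S0 g0).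
  by rewrite ler_nat /M leq_max leqnSn orbT.
suff : (x + y) * cnt M <= (x + y) * ((Q^-1 - g) * M%:R) by rewrite ler_pM2l.
rewrite (le_trans (cntP M nM))//.
have -> : (x + y) * ((Q^-1 - g) * M%:R) = M%:R * y + (x + y) * g * M%:R.
  rewrite /g; field; rewrite gt_eqF//=; lra.
by rewrite lerD2l.
Qed.

(** * Counting and geometric decay *)

Lemma count_le1 (T : eqType) (s : seq T) (p : pred T) : uniq s ->
  (forall x y, x \in s -> y \in s -> p x -> p y -> x = y) -> (count p s <= 1)%N.
Proof.
move=> us inj; rewrite -size_filter.
case E : [seq z <- s | p z] => [//|x [//|y r]].
have := filter_uniq p us; rewrite E /= inE negb_or => /andP[/andP[/eqP xy _] _].
have xP : x \in [seq z <- s | p z] by rewrite E inE eqxx.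
have yP : y \in [seq z <- s | p z] by rewrite E !inE eqxx orbT.
move: xP yP; rewrite !mem_filter => /andP[px xs] /andP[py ys].
by case: xy; apply: inj.
Qed.

Lemma sum_count (V : pzSemiRingType) (T : Type) (s : seq T) (p : pred T) :
  \sum_(x <- s) (p x)%:R = (count p s)%:R :> V.
Proof.
rewrite -sum1_count natr_sum [RHS]big_mkcond.
by apply: eq_bigr => x _; case: (p x).
Qed.

Lemma expr_small (R : realType) (t e : R) : 0 <= t < 1 -> 0 < e ->
  exists n, forall m : nat, (n <= m)%N -> t ^+ m <= e.
Proof.
move=> /andP[t0 t1] e0.
have /cvgr0_norm_le/(_ e e0)[n _ h] : t ^+ m @[m --> \oo] --> 0.
  by apply: cvg_expr; rewrite ger0_norm.
by exists n => m /h /=; rewrite ger0_norm ?exprn_ge0.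
Qed.

(** * Non-Archimedean absolute value *)

Section Valuation.
Variables (R : realType) (F : fieldType) (v : F -> int) (q : nat).
Hypotheses (q_gt1 : (1 < q)%N) (vP : is_dvaluation v).
Local Notation Q := (q%:R : R).
Local Notation av := (@absv R F v q).
Implicit Types (x y z : F) (l k : int).

Lemma Q_gt1 : 1 < Q. Proof. by rewrite ltr1n. Qed.

Lemma Q_gt0 : 0 < Q. Proof. exact: lt_trans Q_gt1. Qed.

Lemma Q_neq0 : Q != 0. Proof. by rewrite gt_eqF ?Q_gt0. Qed.

Lemma QX_gt0 k : 0 < Q ^ k. Proof. by rewrite exprz_gt0 ?Q_gt0. Qed.

Lemma absv0 : av 0 = 0. Proof. by rewrite /absv eqxx. Qed.

Lemma absv_nz x : x != 0 -> av x = Q ^ (- v x).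
Proof. by rewrite /absv => /negbTE ->. Qed.

Lemma absv_ge0 x : 0 <= av x.
Proof. by rewrite /absv; case: ifP => // _; rewrite ltW ?QX_gt0. Qed.

Lemma absvM x y : av (x * y) = av x * av y.
Proof.
have [->|x0] := eqVneq x 0; first by rewrite mul0r absv0 mul0r.
have [->|y0] := eqVneq y 0; first by rewrite mulr0 absv0 mulr0.
rewrite !absv_nz ?mulf_neq0//; case: vP => -> // _ _.
by rewrite opprD expfzDr ?Q_neq0.
Qed.

Lemma absv1 : av 1 = 1.
Proof.
have: av 1 * av 1 = 1 * av 1 by rewrite -absvM !mul1r.
by apply: mulIf; rewrite absv_nz ?oner_neq0// gt_eqF ?QX_gt0.
Qed.

Lemma absvN x : av (- x) = av x.
Proof.
suff avN1 : av (- 1) = 1 by rewrite -mulN1r absvM avN1 mul1r.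
have: av (- 1) ^+ 2 = 1 by rewrite expr2 -absvM mulrNN mulr1 absv1.
by move/eqP; rewrite sqrf_eq1 => /orP[/eqP//|/eqP e]; have := absv_ge0 (- 1); lra.
Qed.

Lemma absvB x y : av (x - y) = av (y - x).
Proof. by rewrite -absvN opprB. Qed.

Lemma absvD_le x y (b : R) : av x <= b -> av y <= b -> av (x + y) <= b.
Proof.
move=> xb yb.
have [xy0|xy0] := eqVneq (x + y) 0.
  by rewrite xy0 absv0 (le_trans (absv_ge0 x)).
have [x0|x0] := eqVneq x 0; first by rewrite x0 add0r.
have [y0|y0] := eqVneq y 0; first by rewrite y0 addr0.
case: vP => _ /(_ x y x0 y0 xy0) + _; rewrite ge_min.
move: xb yb; rewrite !absv_nz// => xb yb /orP[] h.
  by apply: le_trans xb; rewrite ler_eXz2l ?Q_gt1// lerN2.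
by apply: le_trans yb; rewrite ler_eXz2l ?Q_gt1// lerN2.
Qed.

Lemma absv_lt1 x : av x < 1 -> av x <= Q ^ (- 1).
Proof.
have [->|x0] := eqVneq x 0; first by rewrite absv0 ltW ?QX_gt0.
rewrite absv_nz// -(expr0z Q) ltr_eXz2l ?Q_gt1// ler_eXz2l ?Q_gt1//; lia.
Qed.

Lemma absv_exprz x k : x != 0 -> av (x ^ k) = av x ^ k.
Proof.
have avX n : av (x ^+ n) = av x ^+ n.
  by elim: n => [|n IH]; rewrite ?expr0 ?absv1// !exprS absvM IH.
have avV y : y != 0 -> av y^-1 = (av y)^-1.
  move=> y0; have avy : av y != 0 by rewrite absv_nz// gt_eqF ?QX_gt0.
  by apply: (mulIf avy); rewrite -absvM !mulVf// absv1.
by case: k => n x0; rewrite ?NegzE -?exprnN -?exprnP ?avV ?expf_neq0// avX.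
Qed.

(* [x] and [y] are congruent modulo [pi ^ l]. *)
Definition agree x y l := av (x - y) <= Q ^ (- l).

Lemma agree_refl x l : agree x x l.
Proof. by rewrite /agree subrr absv0 ltW ?QX_gt0. Qed.

Lemma agree_sym x y l : agree x y l = agree y x l.
Proof. by rewrite /agree absvB. Qed.

Lemma agree_trans y x z l : agree x y l -> agree y z l -> agree x z l.
Proof.
rewrite /agree => xy yz.
have -> : x - z = (x - y) + (y - z) by rewrite addrA subrK.
exact: absvD_le.
Qed.

Lemma agree_le x y l k : l <= k -> agree x y k -> agree x y l.
Proof.
move=> lk; rewrite /agree => /le_trans; apply.
by rewrite ler_eXz2l ?Q_gt1// lerN2.
Qed.

Lemma absv_level (b : R) : 0 < b -> exists n : nat, Q ^ (- n%:Z) <= b.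
Proof.
move=> b0; exists (Num.Def.archi_bound b^-1).
have bn : b^-1 <= Q ^+ Num.Def.archi_bound b^-1.
  have := archi_boundP (ltW (_ : 0 < b^-1)); rewrite invr_gt0 => /(_ b0) /ltW.
  move=> /le_trans; apply; rewrite -natrX ler_nat ltnW //.
  exact: ltn_expl.
rewrite -exprnN -[leRHS]invrK lef_pV2 ?posrE ?invr_gt0 ?exprn_gt0 ?Q_gt0 //.
Qed.

Variable pi : F.
Hypotheses (pi0 : pi != 0) (vpi : v pi = 1).

Lemma absv_piX k : av (pi ^ k) = Q ^ (- k).
Proof. by rewrite absv_exprz// absv_nz// vpi exprz_exp mulN1r. Qed.

Lemma absv_mulpi_le x k l : (av (x * pi ^ k) <= Q ^ l) = (av x <= Q ^ (l + k)).
Proof.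
by rewrite absvM absv_piX expfzDr ?Q_neq0// -ler_pdivrMr ?QX_gt0 // invr_expz.
Qed.

(** * Digit expansions *)

Lemma rep_ex (D : seq F) x : @rep_system R F v q D -> av x <= 1 ->
  exists2 c, c \in D & av (x - c) < 1.
Proof. by move=> [_ h] /h [c [[cD xc] _]]; exists c. Qed.

Lemma rep_inj (D : seq F) : @rep_system R F v q D ->
  forall c d, c \in D -> d \in D -> agree c d 1 -> c = d.
Proof.
move=> [D1 h] c d cD dD; rewrite /agree => cd.
have [e [_ eu]] := h c (D1 c cD).
rewrite -(eu c) -1?(eu d)//; split=> //; last by rewrite subrr absv0.
by apply: le_lt_trans cd _; rewrite -(expr0z Q) ltr_eXz2l ?Q_gt1.
Qed.

Section Digits.
Variable C : seq F.
Hypotheses (hC : @rep_system R F v q C) (hC0 : 0 \in C).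
Local Notation is_exp := (@is_expansion R F v q C pi).

Definition fracsum (a : nat -> F) (m : nat) :=
  \sum_(i < m) a i * pi ^ (i%:Z - m%:Z).

(** Greedy choice: rescale the remainder after [k] digits into the valuation ring and take its
    representative as next digit; a value below [1] is at most [Q ^ (- 1)], so each digit gains one
    power of [pi]. *)
Lemma expansion_ex x (m : nat) : av x <= Q ^ m%:Z -> exists a, is_exp x a m.
Proof.
move=> xm.
have /choice[dg dgP] : forall y, exists c, c \in C /\ (av y <= 1 -> av (y - c) < 1).
  move=> y; have [y1|y1] := boolP (av y <= 1).
    by have [c cC yc] := rep_ex hC y1; exists c.
  by exists 0.
pose rem := fix rem (k : nat) := if k is j.+1 then
  rem j - dg (rem j * pi ^ (m%:Z - j%:Z)) * pi ^ (j%:Z - m%:Z) else x.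
pose a (k : nat) := dg (rem k * pi ^ (m%:Z - k%:Z)).
have remE (k : nat) : rem k = x - \sum_(i < k) a i * pi ^ (i%:Z - m%:Z).
  elim: k => [|k IH]; first by rewrite big_ord0 subr0.
  by rewrite big_ord_recr /= opprD addrA -IH.
exists a; split=> [i|k]; first by case: (dgP (rem i * pi ^ (m%:Z - i%:Z))).
rewrite -remE; elim: k => [|k IH]; first by rewrite sub0r opprK.
have rk : rem k = rem k * pi ^ (m%:Z - k%:Z) * pi ^ (k%:Z - m%:Z).
  by rewrite -mulrA -expfzDr// addrC subrKA subrr mulr1.
have -> : rem k.+1 = (rem k * pi ^ (m%:Z - k%:Z) - a k) * pi ^ (k%:Z - m%:Z).
  by rewrite mulrBl -rk.
rewrite absv_mulpi_le.
have -> : - (k.+1%:Z - m%:Z) + (k%:Z - m%:Z) = - 1 by lia.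
apply: absv_lt1; apply: (dgP _).2; rewrite -(expr0z Q) absv_mulpi_le.
by have -> : 0 + (m%:Z - k%:Z) = - (k%:Z - m%:Z) by lia.
Qed.

(** Once the earlier digits coincide, the partial sums differ in a single term, so the next digits
    are congruent modulo [pi] and hence equal as representatives. *)
Lemma expansion_agree x y a b (m k : nat) : is_exp x a m -> is_exp y b m ->
  agree x y (k%:Z - m%:Z) -> forall i, (i < k)%N -> a i = b i.
Proof.
move=> [aC xa] [bC yb]; elim: k => // k IH xy.
have ab i : (i < k)%N -> a i = b i.
  by apply: IH; apply: agree_le xy; lia.
move=> i; rewrite ltnS leq_eqVlt => /orP[/eqP ->|/ab//].
apply: (rep_inj hC) => //; rewrite /agree.
have -> : (- 1 : int) = - (k.+1%:Z - m%:Z) + (k%:Z - m%:Z) by lia.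
rewrite -absv_mulpi_le.
have := xa k.+1; have := yb k.+1; rewrite !big_ord_recr /=.
under [X in _ - (X + _)]eq_bigr => j _ do rewrite -ab//.
set S := \sum_(j < k) _ => yk xk.
have -> : (a k - b k) * pi ^ (k%:Z - m%:Z) =
    - (x - (S + a k * pi ^ (k%:Z - m%:Z))) +
    ((y - (S + b k * pi ^ (k%:Z - m%:Z))) + (x - y)) by ring.
by apply: absvD_le; rewrite ?absvN//; apply: absvD_le.
Qed.

(** Leading zeros, which are digits because [0] lies in [C], bring two expansions with different
    starting exponents to a common one. *)
Definition pad (d : nat) (a : nat -> F) i := if (i < d)%N then 0 else a (i - d)%N.

Lemma sum_pad a (m d k : nat) :
  \sum_(i < d + k) pad d a i * pi ^ (i%:Z - (d + m)%:Z) =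
  \sum_(i < k) a i * pi ^ (i%:Z - m%:Z).
Proof.
rewrite big_split_ord /= big1 ?add0r => [|i _]; last by rewrite /pad ltn_ord mul0r.
apply: eq_bigr => i _; rewrite /pad /= ltnNge leq_addr /= addKn.
by congr (_ * _ ^ _); lia.
Qed.

Lemma expansion_pad x a (m d : nat) : is_exp x a m -> is_exp x (pad d a) (d + m).
Proof.
move=> [aC xa]; split=> [i|k]; first by rewrite /pad; case: ifP.
have [dk|kd] := leqP d k.
  have -> : k = (d + (k - d))%N by lia.
  rewrite sum_pad.
  by have -> : (d + (k - d))%N%:Z - (d + m)%N%:Z = (k - d)%N%:Z - m%:Z by lia.
rewrite big1 => [|i _]; last by rewrite /pad (ltn_trans _ kd)// mul0r.
have := xa 0%N; rewrite big_ord0 => /le_trans; apply; rewrite ler_eXz2l ?Q_gt1//; lia.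
Qed.

Lemma digit_agree x y a b (m n : nat) : is_exp x a m -> is_exp y b n ->
  agree x y 1 -> a m = b n.
Proof.
move=> /(expansion_pad n) xa /(expansion_pad m) yb xy.
rewrite addnC in xa; have := expansion_agree (k := (m + n).+1) xa yb.
have -> : ((m + n).+1%:Z - (m + n)%N%:Z) = 1 by lia.
move=> /(_ xy _ (ltnSn _)).
by rewrite /pad !ltnNge leq_addr leq_addl /= addnK addKn.
Qed.

Lemma fracsum_agree x y a b (m n : nat) : is_exp x a m -> is_exp y b n ->
  agree x y 0 -> fracsum a m = fracsum b n.
Proof.
move=> /(expansion_pad n) xa /(expansion_pad m) yb xy.
rewrite /fracsum -(sum_pad a m n m) -(sum_pad b n m n).
rewrite (addnC n m) in xa *.
have := expansion_agree (k := (m + n)%N) xa yb; rewrite subrr => /(_ xy) ab.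
by apply: eq_bigr => i _; rewrite ab.
Qed.

Lemma head_agree x a (m : nat) : is_exp x a m -> agree (x - fracsum a m) (a m) 1.
Proof.
move=> [_ /(_ m.+1)]; rewrite big_ord_recr /= subrr expr0z mulr1 opprD addrA.
by rewrite /agree /fracsum; have -> : m.+1%:Z - m%:Z = 1 by lia.
Qed.

Lemma exists_expansion x : exists a m, is_exp x a m.
Proof.
have [m xm] : exists m : nat, av x <= Q ^ m%:Z.
  have [->|x0] := eqVneq x 0; first by exists 0%N; rewrite absv0 ltW ?QX_gt0.
  exists `|v x|%N; rewrite absv_nz// ler_eXz2l ?Q_gt1//; lia.
by have [a xa] := expansion_ex xm; exists a, m.
Qed.

Local Notation dig := (@digit0 R F v q C pi).
Local Notation ipart := (@intpart R F v q C pi).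

(** [digit0] picks among all expansions of [x]; it suffices to know that its value comes from some
    expansion, since [digit_agree] makes the choice harmless. *)
Lemma digit0_spec x : exists a m, is_exp x a m /\ dig x = a m.
Proof.
have [a [m xa]] := exists_expansion x.
rewrite /digit0; case: xgetP => [c -> [b [n [xb <-]]]|/(_ (a m)) []].
  by exists b, n.
by exists a, m.
Qed.

Lemma intpart_spec x : exists a m, is_exp x a m /\ ipart x = x - fracsum a m.
Proof.
have [a [m xa]] := exists_expansion x.
rewrite /intpart; case: xgetP => [c -> [b [n [xb ->]]]|/(_ (x - fracsum a m)) []].
  by exists b, n.
by exists a, m.
Qed.

Lemma digit0_in x : dig x \in C.
Proof. by have [a [m [[aC _] ->]]] := digit0_spec x. Qed.

Lemma digit0_agree x y : agree x y 1 -> dig x = dig y.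
Proof.
have [a [m [xa ->]]] := digit0_spec x; have [b [n [yb ->]]] := digit0_spec y.
exact: digit_agree.
Qed.

(** Points that differ by an integral element share their digits at negative powers of [pi]; with
    equal [0]-digits the first possible difference is at [pi] itself. *)
Lemma digit0_inj x y : agree x y 0 -> dig x = dig y -> agree x y 1.
Proof.
have [a [m [xa ->]]] := digit0_spec x; have [b [n [yb ->]]] := digit0_spec y.
move=> xy ab; have := head_agree xa; rewrite (fracsum_agree xa yb xy).
have := head_agree yb; rewrite agree_sym ab => yB xA.
by have := agree_trans xA yB; rewrite /agree opprB addrA subrK.
Qed.

Lemma intpart_digit0 x : agree (ipart x) (dig x) 1.
Proof.
have [a [m [xa ->]]] := digit0_spec x; have [b [n [xb ->]]] := intpart_spec x.
rewrite (digit_agree xa xb (agree_refl _ _)).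
exact: head_agree.
Qed.

(** The digit is [c] exactly when the integral part lies in the disk of radius [Q ^ (- 1)] around
    [c], so the case [k = 1] suffices. *)
Lemma ud_O_symbols (s : nat -> F) : @ud_O R F v q (ipart \o s) ->
  @ud_symbols R F q C (dig \o s).
Proof.
move=> ud c cC; have := ud c (hC.1 c cC) 1%N.
rewrite exprN1; set u := (X in X @ _ --> _); set w := (X in _ -> X @ _ --> _).
suff -> : u = w by [].
apply/funext => N; congr (_%:R / _); apply: eq_count => n /=.
apply/idP/eqP => [sc|<-]; last exact: intpart_digit0.
apply: (rep_inj hC); rewrite ?digit0_in//.
have {}sc : agree (ipart (s n)) c 1 := sc.
by apply: agree_trans sc; rewrite agree_sym intpart_digit0.
Qed.
End Digits.

(** * Subballs and the upper bound *)

(** For [c] in a system of representatives, these are centres of the subballs of level [l + 1] in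
    the ball of level [l] around [y]. *)
Definition child y l c := y + c * pi ^ l.

Lemma agree_scale x y l k : agree (x * pi ^ l) (y * pi ^ l) (l + k) = agree x y k.
Proof. by rewrite /agree -mulrBl absv_mulpi_le; congr (_ <= _ ^ _); lia. Qed.

Section Residues.
Variable D : seq F.
Hypotheses (hD : @rep_system R F v q D) (sD : size D = q).

Lemma child_ex x y l : agree x y l -> exists2 c, c \in D & agree x (child y l c) (l + 1).
Proof.
rewrite /agree => xy.
have : av ((x - y) * pi ^ (- l)) <= 1.
  by rewrite -(expr0z Q) absv_mulpi_le add0r.
move=> /(rep_ex hD)[c cD /absv_lt1 xyc]; exists c => //.
have -> : x - child y l c = ((x - y) * pi ^ (- l) - c) * pi ^ l.
  by rewrite mulrBl -mulrA -expfzDr// addNr mulr1 /child opprD addrA.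
by rewrite absv_mulpi_le opprD addrAC addNr add0r.
Qed.

Lemma child_agree y l c : c \in D -> agree (child y l c) y l.
Proof.
move=> cD; rewrite /agree /child addrC addKr absv_mulpi_le.
by rewrite addNr expr0z (hD.1 c).
Qed.

Lemma child_inj y l c d : c \in D -> d \in D ->
  agree (child y l c) (child y l d) (l + 1) -> c = d.
Proof.
move=> cD dD cd; apply: (rep_inj hD) => //; rewrite -(agree_scale _ _ l).
by move: cd; rewrite /agree /child opprD addrACA subrr add0r.
Qed.

Lemma ball_cover a l (k : nat) : exists2 s : seq F, size s = (q ^ k)%N &
  forall x, agree x a l -> exists2 y, y \in s & agree x y (l + k%:Z).
Proof.
elim: k => [|k [s ss sP]].
  by exists [:: a] => // x xa; exists a; rewrite ?mem_head ?addr0.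
exists [seq child y (l + k%:Z) c | y <- s, c <- D].
  by rewrite size_allpairs ss sD expnSr.
move=> x /sP[y ys /child_ex[c cD xc]]; exists (child y (l + k%:Z) c).
  exact: allpairs_f.
by move: xc; congr (is_true (agree _ _ _)); lia.
Qed.

Local Notation diam := (@ediam R F v q).

Lemma ediam_le (U : set F) (b : R) : (forall x y, U x -> U y -> av (x - y) <= b) ->
  (diam U <= b%:E)%E.
Proof. by move=> Ub; apply: ge_ereal_sup => _ [x Ux [y Uy <-]]; rewrite lee_fin Ub. Qed.

Lemma fine_ediam_ge0 (U : set F) : 0 <= fine (diam U).
Proof.
have [->|/set0P[x Ux]] := eqVneq U set0.
  (* The empty set has diameter [-oo], which [fine] sends to [0]. *)
  rewrite /ediam (_ : [set _ | _ in _ & _ in _] = set0) ?ereal_sup0//.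
  by rewrite -subset0 => _ [x []].
rewrite fine_ge0// (@le_trans _ _ (av (x - x))%:E) ?lee_fin ?absv_ge0//.
by apply: ereal_sup_ubound; exists x => //; exists x.
Qed.

Lemma fine_ediam_le (U : set F) (b : R) : 0 <= b -> (diam U <= b%:E)%E ->
  fine (diam U) <= b.
Proof. by case: (diam U) => [r| |] //=; rewrite lee_fin. Qed.

Lemma hausdorff_pre_ge0 (s d : R) (A : set F) : (0 <= @hausdorff_pre R F v q s d A)%E.
Proof.
apply: le_ereal_inf_tmp => _ [U _ <-].
by apply: nneseries_ge0 => i _ _; rewrite lee_fin powR_ge0.
Qed.

(** The [q ^ k] balls of level [l + k] cost a constant times [t ^+ k] in all, and [t], the power of
    [Q] with exponent [1 - s], is below [1]. *)
Lemma hausdorff_measure_ball (s : R) (A : set F) a l : 1 < s ->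
  (forall x, A x -> agree x a l) -> @hausdorff_measure R F v q s A = 0%E.
Proof.
move=> s1 Aa; apply/eqP; rewrite eq_le; apply/andP; split; last first.
  apply: le_trans (hausdorff_pre_ge0 s 1 A) _.
  by apply: ereal_sup_ubound; exists 1 => /=.
apply: ge_ereal_sup => _ [d /= d0 <-]; apply/lee_addgt0Pr => e e0; rewrite add0e.
pose t := Q `^ (1 - s); pose T (k : nat) := Q ^ (- (l + k%:Z)).
have Tq (k : nat) : Q ^+ k * T k `^ s = Q `^ (- (l%:~R * s)) * t ^+ k.
  rewrite /T -powR_intmul ?ler0n// -powRrM -!powR_mulrn ?powR_ge0// ?ler0n//.
  rewrite -powRrM -!powRD ?Q_neq0 ?implybT//; congr (_ `^ _).
  by rewrite !rmorphN rmorphD/=; ring.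
have t01 : 0 <= t < 1.
  rewrite powR_ge0 /t /powR (negbTE Q_neq0) expR_lt1.
  by rewrite nmulr_rlt0 ?ln_gt0 ?Q_gt1// subr_lt0.
have [n1 n1P] := expr_small t01 (divr_gt0 e0 (powR_gt0 (- (l%:~R * s)) Q_gt0)).
have Q01 : 0 <= Q^-1 < 1.
  by rewrite invr_ge0 ltW ?Q_gt0// invf_lt1 ?Q_gt0 ?Q_gt1.
have [n2 n2P] := expr_small Q01 (divr_gt0 d0 (QX_gt0 (- l))).
(* [n1] brings the total cost down to [e], and [n2] brings the radius down to [d]. *)
pose k := maxn n1 n2; have [c sc cP] := ball_cover a l k.
(* Covers are indexed by [nat], so empty sets fill up the sequence; they cost [0] because [s] is
   nonzero. *)
pose U i := if (i < q ^ k)%N then [set x | agree x (nth 0 c i) (l + k%:Z)] else set0.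
have dU i : (diam (U i) <= (T k)%:E)%E.
  apply: ediam_le => x y; rewrite /U; case: ifP => // _ /= xc yc.
  by apply: agree_trans xc _; rewrite agree_sym.
have Td : T k <= d.
  rewrite /T opprD expfzDr ?Q_neq0// -ler_pdivlMl ?QX_gt0//.
  rewrite -exprnN -exprVn mulrC; apply: n2P; exact: leq_maxr.
apply: ge_ereal_inf; eexists; first exists U; first split=> [x /Aa/cP[y yc xy]|i].
- exists (index y c) => //; rewrite /U -sc index_mem yc /=.
  by rewrite nth_index.
- by apply: le_trans (dU i) _; rewrite lee_fin.
- by [].
rewrite (nneseries_split 0 (q ^ k)) => [|i _]; last by rewrite lee_fin powR_ge0.
rewrite eseries0 ?adde0 => [|i]; last first.
  rewrite add0n => ki _; congr (_%:E); apply/eqP; rewrite powR_eq0.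
  rewrite (gt_eqF (lt_trans ltr01 s1)) andbT eq_le fine_ediam_ge0 andbT.
  by apply: fine_ediam_le => //; apply: ediam_le => x y; rewrite /U ltnNge ki.
rewrite sumEFin lee_fin add0n.
apply: (@le_trans _ _ (\sum_(0 <= i < q ^ k) T k `^ s)).
  apply: ler_sum => i _; apply: ge0_ler_powR; rewrite ?nnegrE ?fine_ediam_ge0//.
  - by rewrite ltW// (lt_trans ltr01).
  - by rewrite ltW ?QX_gt0.
  - by rewrite fine_ediam_le ?dU// ltW ?QX_gt0.
rewrite sumr_const_nat subn0 -mulr_natl natrX Tq -ler_pdivlMl ?powR_gt0 ?Q_gt0//.
by rewrite mulrC n1P ?leq_maxl.
Qed.

Lemma hausdorff_dim_le1 (A : set F) a (r : R) : 0 < r -> A `<=` @disk R F v q a r ->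
  (@hausdorff_dim R F v q A <= 1%:E)%E.
Proof.
move=> r0 Ar; have /absv_level[n rn] : 0 < r^-1 by rewrite invr_gt0.
apply/lee_addgt0Pr => e e0; apply: ereal_inf_lbound; exists (1 + e) => //.
split; first by rewrite addr_gt0.
apply: (@hausdorff_measure_ball _ _ a (- n%:Z)); first by rewrite ltrDl.
move=> x /Ar /le_trans; apply; rewrite opprK.
by move: rn; rewrite -exprnN lef_pV2 ?posrE ?exprn_gt0 ?Q_gt0.
Qed.

(** * The lower bound *)

(* Rounds a diameter [rho] up to a power of [q]; the error [e] pays for
   [rho = 0]. *)
Lemma ball_weight (s rho e : R) (L : int) : 0 < s -> 0 <= rho <= Q ^ (- L) -> 0 < e ->
  exists b : nat, rho <= Q ^ (- (L + b%:Z)) /\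
    (Q `^ (- s)) ^+ b <= Q `^ (s + L%:~R * s) * rho `^ s + e.
Proof.
move=> s0 /andP[rho0 rhoL] e0; pose t := Q `^ (- s).
(* In the constant, the exponent [L%:~R * s] normalises by the radius [Q ^ (- L)], and the extra [s]
   pays for rounding [rho] up by a factor of at most [Q]. *)
have tE (b : nat) : t ^+ b = Q `^ (s + L%:~R * s) * (Q ^ (- (L + b.+1%:Z))) `^ s.
  rewrite /t -powR_intmul ?ler0n// -powR_mulrn ?powR_ge0// -!powRrM.
  rewrite -powRD ?Q_neq0 ?implybT//.
  by congr (_ `^ _); rewrite !rmorphN rmorphD/= -[b.+1%:~R]natr1; ring.
have [/ex_minnP[b rhob bmin]|rhosmall] :=
    pselect (exists b : nat, Q ^ (- (L + b.+1%:Z)) < rho).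
  exists b; split.
    case: b rhob bmin => [|b] _ bmin; first by rewrite addr0.
    by rewrite leNgt; apply/negP => /bmin; rewrite ltnn.
  rewrite -[leLHS]addr0 lerD ?(ltW e0)// tE ler_wpM2l ?powR_ge0//.
  by apply: ge0_ler_powR; rewrite ?nnegrE ?(ltW s0) ?(ltW (QX_gt0 _)) ?(ltW rhob).
have t01 : 0 <= t < 1.
  rewrite powR_ge0 /t /powR (negbTE Q_neq0) expR_lt1.
  by rewrite nmulr_rlt0 ?ln_gt0 ?Q_gt1// oppr_lt0.
(* Here [rho] is below every radius, so [b] can be as large as [e] requires. *)
have [n nP] := expr_small t01 e0; exists n.+1; split.
  by rewrite leNgt; apply/negP => h; apply: rhosmall; exists n.
by rewrite (le_trans (nP _ (leqnSn n)))// lerDr mulr_ge0 ?powR_ge0.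
Qed.

Hypothesis uD : uniq D.

(** * Greedy descent to a point outside the cover *)

Section Escape.
Hypothesis cplt : @complete_absv R F v q.
Variables (t : R) (L : int) (a : F) (h : nat -> F -> R) (u : nat -> F) (b : nat -> nat).
Hypotheses (t_ge0 : 0 <= t) (h_ge0 : forall j x, 0 <= h j x)
  (h_le : forall j x, h j x <= Q * t)
  (h_local : forall j x y, agree x a L -> agree x y (L + j.+1%:Z) -> h j x = h j y)
  (h_sum : forall j y, agree y a L -> Q <= \sum_(c <- D) h j (child y (L + j%:Z) c))
  (w_sum : (\sum_(0 <= i <oo) (t ^+ b i)%:E < (2^-1 : R)%:E)%E).

(* The cover set number [i] is enlarged to the ball of level [L + b i] around
   [u i], of cost [t ^+ b i]; [pot j y] is the potential of the ball of level
   [L + j] around [y]. *)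
Let hit i j y := (j <= b i)%N && agree (u i) y (L + j%:Z).
Let load j y : \bar R := (\sum_(0 <= i <oo) (t ^+ b i * (hit i j y)%:R)%:E)%E.
Let pot j y : R := fine (load j y) + 2^-1 * Q^-1 ^+ j.

Let term_ge0 i j y : (0 <= (t ^+ b i * (hit i j y)%:R)%:E)%E.
Proof. by rewrite lee_fin mulr_ge0 ?exprn_ge0. Qed.

Let load_ge0 j y : (0 <= load j y)%E.
Proof. by apply: nneseries_ge0 => i _ _. Qed.

Let load_lt j y : (load j y < (2^-1 : R)%:E)%E.
Proof.
apply: le_lt_trans w_sum; apply: lee_nneseries => i // _.
by rewrite lee_fin -[leRHS]mulr1 ler_wpM2l ?exprn_ge0// lern1 leq_b1.
Qed.

Let load_fin j y : load j y = (fine (load j y))%:E.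
Proof. by rewrite fineK// ge0_fin_numE// (lt_trans (load_lt j y))// ltry. Qed.

Let pot_ge0 j y : 0 <= pot j y.
Proof.
by rewrite addr_ge0 ?fine_ge0// mulr_ge0 ?invr_ge0// exprn_ge0// invr_ge0.
Qed.

(** Children are disjoint, so a ball counted at [y] is counted in at most one child; a ball of level
    exactly [L + j] drops out. *)
Let load_children j y :
  \sum_(c <- D) fine (load j.+1 (child y (L + j%:Z) c)) <= fine (load j y).
Proof.
rewrite -lee_fin -load_fin -sumEFin.
under eq_bigr => c _ do rewrite -load_fin.
rewrite -nneseries_sum//; apply: lee_nneseries => [i _ _|i _]; first exact: sume_ge0.
rewrite sumEFin lee_fin -mulr_sumr ler_wpM2l ?exprn_ge0// sum_count ler_nat.
case: (boolP (hit i j y)) => [_|nhit].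
  apply: count_le1 => // c d cD dD /andP[_ uc] /andP[_ ud].
  apply: (@child_inj y (L + j%:Z)) => //; apply: (@agree_trans (u i)).
    by rewrite agree_sym; move: uc; congr (is_true (agree _ _ _)); lia.
  by move: ud; congr (is_true (agree _ _ _)); lia.
rewrite leqn0 eqn0Ngt -has_count; apply/hasPn => c cD; apply: contra nhit.
move=> /andP[jb uc]; rewrite /hit (ltnW jb) /=.
apply: (@agree_trans (child y (L + j%:Z) c)); last exact: child_agree.
by apply: agree_le uc; lia.
Qed.

(** If every child exceeded the bound, summing over the children would contradict [h_sum] and the
    superadditivity of [pot]. *)
Let descend j y : agree y a L -> exists y', agree y' y (L + j%:Z) /\
  pot j.+1 y' <= h j y' / Q * pot j y.
Proof.
move=> ya; apply: contrapT => no.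
have lt_child c : c \in D ->
    h j (child y (L + j%:Z) c) / Q * pot j y < pot j.+1 (child y (L + j%:Z) c).
  move=> cD; rewrite ltNge; apply/negP => le_pot; apply: no.
  by exists (child y (L + j%:Z) c); split=> //; exact: child_agree.
have : \sum_(c <- D) h j (child y (L + j%:Z) c) / Q * pot j y <
       \sum_(c <- D) pot j.+1 (child y (L + j%:Z) c).
  rewrite big_seq [ltRHS]big_seq; apply: ltr_sum => //.
  have [c cD _] : exists2 c, c \in D & av (0 - c) < 1.
    by apply: (rep_ex hD); rewrite absv0.
  by apply/hasP; exists c.
apply/negP; rewrite -leNgt (@le_trans _ _ (pot j y))//.
  rewrite /pot big_split /= lerD ?load_children// big_const_seq count_predT sD.
  rewrite iter_addr_0 -[leLHS]mulr_natl exprS [_ * (Q^-1 * _)]mulrCA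
    mulVKf ?Q_neq0//.
rewrite -mulr_suml -mulr_suml ler_peMl// ler_pdivlMr ?Q_gt0// mul1r.
exact: h_sum.
Qed.

Lemma escape : exists x, [/\ agree x a L,
  forall i, ~~ agree (u i) x (L + (b i)%:Z) &
  forall j, 2^-1 <= \prod_(i < j) h i x].
Proof.
have /choice[step stepP] : forall p : nat * F, exists y', agree p.2 a L ->
    agree y' p.2 (L + p.1%:Z) /\ pot p.1.+1 y' <= h p.1 y' / Q * pot p.1 p.2.
  move=> [j y]; have [ya|nya] := boolP (agree y a L).
    by have [y' yP] := descend j ya; exists y'.
  by exists y.
pose xs := fix xs (n : nat) := if n is j.+1 then step (j, xs j) else a.
have xsa j : agree (xs j) a L.
  elim: j => [|j IH]; first exact: agree_refl.
  have [/= + _] := stepP (j, xs j) IH.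
  by move=> /(agree_le (_ : L <= _)) => /(_ ltac:(lia)) /agree_trans; apply.
have xsS j := stepP (j, xs j) (xsa j).
have xs_agree j n : (j <= n)%N -> agree (xs n) (xs j) (L + j%:Z).
  elim: n => [|n IH]; first by rewrite leqn0 => /eqP ->; exact: agree_refl.
  rewrite leq_eqVlt => /orP[/eqP ->|]; first exact: agree_refl.
  rewrite ltnS => jn; apply: agree_trans (IH jn).
  by apply: agree_le (xsS n).1; rewrite /=; lia.
have [x xlim] : exists x, forall e : R, 0 < e ->
    exists N, forall n, (N <= n)%N -> av (xs n - x) < e.
  apply: cplt => e e0.
  have /absv_level[N Ne] : 0 < e / 2%:R / Q ^ (- L) by rewrite !divr_gt0 ?QX_gt0.
  exists N => m n mN nN; apply: (@le_lt_trans _ _ (e / 2%:R)); last first.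
    by rewrite gtr_pMr// invf_lt1// ltr1n.
  move: Ne; rewrite ler_pdivlMr ?QX_gt0// -expfzDr ?Q_neq0//; apply: le_trans.
  rewrite [- N%:Z + _]addrC -opprD -/(agree _ _ _).
  apply: (@agree_trans (xs N)); first exact: xs_agree.
  by rewrite agree_sym; exact: xs_agree.
have x_agree j : agree x (xs j) (L + j%:Z).
  have [N NP] := xlim _ (QX_gt0 (- (L + j%:Z))).
  apply: (@agree_trans (xs (maxn N j))); last by rewrite xs_agree ?leq_maxr.
  by rewrite agree_sym /agree ltW// NP ?leq_maxl.
have xa : agree x a L by apply: agree_trans (xsa 0%N); have := x_agree 0%N; rewrite addr0.
(* At the root [pot] is at most [1]: the load is below [2^-1] by [w_sum] and the Haar part equals
   [2^-1]. By [h_local] the weights can be read at the limit [x]. *)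
have potx j : pot j (xs j) <= (\prod_(i < j) h i x) * Q^-1 ^+ j.
  elim: j => [|j IH].
    rewrite big_ord0 mul1r expr0 /pot expr0 mulr1.
    have := load_lt 0 (xs 0%N); rewrite load_fin lte_fin => /ltW; lra.
  have [_ /=] := xsS j; rewrite -/(xs j.+1) => /le_trans; apply.
  rewrite big_ord_recr /= exprS.
  rewrite (_ : h j (step _) = h j x); last first.
    by apply: h_local; [exact: (xsa j.+1)|rewrite agree_sym; exact: (x_agree j.+1)].
  have -> : (\prod_(i < j) h i x * h j x) * (Q^-1 * Q^-1 ^+ j) =
    h j x / Q * ((\prod_(i < j) h i x) * Q^-1 ^+ j) by ring.
  by rewrite ler_wpM2l// mulr_ge0// invr_ge0 ltW// Q_gt0.
have Qj (j : nat) : 0 < Q^-1 ^+ j by rewrite exprn_gt0// invr_gt0 Q_gt0.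
exists x; split=> // [i|j]; last first.
  (* Only the Haar part of the potential is kept here. *)
  rewrite -(ler_pM2r (Qj j)); apply: le_trans (potx j).
  by rewrite lerDr fine_ge0.
apply/negP => ux.
(* Ball [i] would contribute its full cost at step [b i], strictly exceeded thanks to the Haar part,
   whereas [potx] and [h_le] bound the potential by [t ^+ b i]. *)
have : t ^+ b i < pot (b i) (xs (b i)).
  apply: (@le_lt_trans _ _ (fine (load (b i) (xs (b i))))); last first.
    by rewrite ltrDl mulr_gt0// invr_gt0.
  rewrite -lee_fin -load_fin.
  apply: le_trans (nneseries_lim_ge i.+1 _) => [|n _ _]; last exact: term_ge0.
  have hiti : hit i (b i) (xs (b i)) by rewrite /hit leqnn (agree_trans ux (x_agree _)).
  by rewrite big_mkord big_ord_recr /= hiti mulr1 leeDr// sume_ge0.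
apply/negP; rewrite -leNgt; apply: le_trans (potx _) _.
rewrite exprVn ler_pdivrMr ?exprn_gt0 ?Q_gt0// -exprMn mulrC.
rewrite -[leRHS](_ : \prod_(j < b i) (Q * t) = _); last first.
  by rewrite prodr_const card_ord mulrC.
by apply: ler_prod => j _; rewrite h_ge0 h_le.
Qed.
End Escape.

(** Measure zero would give covers of arbitrarily small cost; [escape] then yields a point that
    satisfies the product bound, hence lies in [A], yet is missed by the cover. *)
Lemma hausdorff_measure_neq0 (s : R) (L : int) (a : F) (h : nat -> F -> R) (A : set F) :
  @complete_absv R F v q -> 0 < s ->
  (forall j x, 0 <= h j x) -> (forall j x, h j x <= Q * Q `^ (- s)) ->
  (forall j x y, agree x a L -> agree x y (L + j.+1%:Z) -> h j x = h j y) ->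
  (forall j y, agree y a L -> Q <= \sum_(c <- D) h j (child y (L + j%:Z) c)) ->
  (forall x, agree x a L -> (forall j, 2^-1 <= \prod_(i < j) h i x) -> A x) ->
  @hausdorff_measure R F v q s A <> 0%E.
Proof.
move=> cplt s0 h_ge0 h_le h_local h_sum hA HA0.
pose K := Q `^ (s + L%:~R * s); have K0 : 0 < K by rewrite powR_gt0 ?Q_gt0.
have e8 : 0 < 8^-1 :> R by rewrite invr_gt0.
(* Diameters up to [Q ^ (- L)] can be rounded by [ball_weight] with [b] natural. The rounded costs,
   including errors of total [8^-1], stay below [4^-1 + 8^-1] and so below the [2^-1] that [escape]
   requires. *)
have : (@hausdorff_pre R F v q s (Q ^ (- L)) A < (8^-1 / K)%:E)%E.
  apply: (@le_lt_trans _ _ 0%E); last by rewrite lte_fin divr_gt0.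
  by rewrite -HA0; apply: ereal_sup_ubound; exists (Q ^ (- L)) => //=; exact: QX_gt0.
move=> /ereal_inf_lt[_ [U [AU dU] <-] small].
have /choice[b bP] : forall i, exists b : nat, fine (diam (U i)) <= Q ^ (- (L + b%:Z)) /\
    (Q `^ (- s)) ^+ b <= K * fine (diam (U i)) `^ s + 8^-1 / (2 ^ i.+1)%:R.
  move=> i; apply: ball_weight => //.
  by rewrite fine_ediam_ge0 fine_ediam_le// ltW ?QX_gt0.
(* [u i] is a point of [U i], or junk if [U i] is empty. *)
have /choice[u uP] : forall i, exists y, forall x, U i x -> U i y.
  by move=> i; have [->|/set0P[y Uy]] := eqVneq (U i) set0; [exists a|exists y].
have [||x [xa xu /(hA x xa)/AU[i _ Ux]]] :=
    @escape cplt (Q `^ (- s)) L a h u b _ h_ge0 h_le h_local h_sum _.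
- exact: powR_ge0.
- apply: (@le_lt_trans _ _ (\sum_(0 <= i <oo)
      (K%:E * (fine (diam (U i)) `^ s)%:E + (8^-1 / (2 ^ i.+1)%:R)%:E))%E).
    apply: lee_nneseries => i; first by rewrite lee_fin exprn_ge0 ?powR_ge0.
    by rewrite -EFinM -EFinD lee_fin => _; exact: (bP i).2.
  apply: le_lt_trans (epsilon_trick _ _ _) _ => [i|//|].
    by rewrite -EFinM lee_fin mulr_ge0 ?powR_ge0 ?ltW.
  rewrite nneseriesZl => [|i _]; last by rewrite lee_fin powR_ge0.
  apply: (@lt_trans _ _ (4^-1 + 8^-1 : R)%:E); last by rewrite lte_fin; lra.
  rewrite EFinD lteD2rE// (@lt_le_trans _ _ (K%:E * (8^-1 / K)%:E)%E)//.
    by rewrite lte_pmul2l// lte_fin.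
  by rewrite -EFinM lee_fin mulrC divfK ?gt_eqF//; lra.
(* Both [x] and [u i] lie in [U i], whose diameter is at most the radius of the ball that [x]
   avoids. *)
move: (xu i); rewrite /agree => /negP; apply; apply: le_trans (bP i).1.
rewrite -lee_fin fineK.
  by apply: ereal_sup_ubound; exists (u i); [exact: uP Ux|exists x].
rewrite fin_numElt (le_lt_trans (dU i)) ?ltry// andbT.
apply: (@lt_le_trans _ _ (av (x - x))%:E); first exact: ltNyr.
by apply: ereal_sup_ubound; exists x => //; exists x.
Qed.

(** * Weights read off the digits of the scaling maps *)

Section ScalingMaps.
Variables (a : F) (r : R) (f : nat -> F -> F) (lam : nat -> int).
Hypotheses (hf : forall n, @scaling_on R F v q (@disk R F v q a r) (f n) (lam n))
  (hlam : forall n, lam n < lam n.+1).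

Lemma lam_lt m n : (m < n)%N -> lam m < lam n.
Proof. exact: (homo_ltn lt_trans). Qed.

Lemma lam_ge n : lam 0%N + n%:Z <= lam n.
Proof. by elim: n => [|n IH]; [rewrite addr0|have := hlam n; lia]. Qed.

Variables (n0 : nat).
Let L := lam n0.

(* [rank j] is the least [n >= n0] with [lam n >= L + j]. *)
Fixpoint rank (j : nat) : nat :=
  if j is i.+1 then (if lam (rank i) == L + i%:Z then (rank i).+1 else rank i) else n0.

Lemma rank_le j : L + j%:Z <= lam (rank j).
Proof.
elim: j => [|j IH] /=; first by rewrite addr0.
by case: eqP => [e|]; [have := hlam (rank j)|]; lia.
Qed.

Lemma rank_gt j n : (n0 <= n < rank j)%N -> lam n < L + j%:Z.
Proof.
elim: j => [|j IH] /=; first by lia.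
move=> /andP[n0n]; case: eqP => [e|_] nj; last first.
  by apply: lt_trans (IH _) _; rewrite ?n0n//; lia.
move: nj; rewrite ltnS leq_eqVlt => /orP[/eqP ->|nj]; first by lia.
by apply: lt_trans (IH _) _; rewrite ?n0n//; lia.
Qed.

Lemma rank_ge j : (n0 <= rank j)%N.
Proof. by elim: j => //= j IH; case: ifP => // _; lia. Qed.

(** Transfers bounds from levels to indices: at [j = lam n - L], [rank_le] and [rank_gt] squeeze
    [rank j] to [n]. *)
Lemma rank_surj n : (n0 <= n)%N -> exists j, rank j = n.
Proof.
move=> n0n; have Ln : L <= lam n.
  by move: n0n; rewrite leq_eqVlt => /orP[/eqP <-//|/lam_lt/ltW].
exists `|lam n - L|%N; apply/eqP; rewrite eqn_leq; apply/andP; split.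
  rewrite leqNgt; apply/negP => nr.
  have := @rank_gt `|lam n - L|%N n; rewrite n0n nr => /(_ isT); lia.
rewrite leqNgt; apply/negP => /lam_lt; have := rank_le `|lam n - L|; lia.
Qed.

Variables (C : seq F) (p0 p1 : R).
Local Notation dig := (@digit0 R F v q C pi).
Definition digit_weight n y : R := if dig (f n y) == 0 then p0 else p1.
Definition level_weight j y : R :=
  if lam (rank j) == L + j%:Z then digit_weight (rank j) y else 1.

(** Levels that are no [lam n] contribute the factor [1], so a product over levels is a product over
    indices. *)
Lemma prod_rank j y :
  \prod_(i < j) level_weight i y = \prod_(n0 <= n < rank j) digit_weight n y.
Proof.
elim: j => [|j IH]; first by rewrite big_ord0 big_geq.
rewrite big_ord_recr /= IH /level_weight; case: ifP => _; last by rewrite mulr1.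
by rewrite big_nat_recr ?rank_ge.
Qed.

Hypotheses (hC : @rep_system R F v q C) (hC0 : 0 \in C).
Hypothesis n0r : Q ^ (- lam n0) <= r.

Let in_disk x : agree x a L -> @disk R F v q a r x.
Proof. by move=> xa; exact: le_trans xa n0r. Qed.

Lemma scaling_agree n x y k : agree x a L -> agree y a L ->
  agree (f n x) (f n y) k = agree x y (k + lam n).
Proof.
move=> /in_disk xr /in_disk yr.
rewrite /agree (hf _ xr yr) -ler_pdivlMl ?QX_gt0// invr_expz -expfzDr ?Q_neq0//.
by congr (_ <= _ ^ _); lia.
Qed.

Lemma weight_local j x y : agree x a L -> agree x y (L + j.+1%:Z) ->
  level_weight j x = level_weight j y.
Proof.
move=> xa xy; rewrite /level_weight; case: eqP => // e.
rewrite /digit_weight (digit0_agree hC hC0 (y := f (rank j) y))//.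
have ya : agree y a L.
  by apply: agree_trans xa; rewrite agree_sym; apply: agree_le xy; lia.
by rewrite scaling_agree// e; move: xy; congr (is_true (agree _ _ _)); lia.
Qed.

(** Digit [0] lowers a weight from [1 + e] by [Q * e], and at most one child has it: two children
    with equal digits would have images congruent modulo [pi], hence coincide by scaling. *)
Lemma weight_sum (e : R) : 0 <= e -> p0 = 1 - (Q - 1) * e -> p1 = 1 + e ->
  forall j y, agree y a L -> Q <= \sum_(c <- D) level_weight j (child y (L + j%:Z) c).
Proof.
move=> e0 p0E p1E j y ya; rewrite /level_weight; case: eqP => [lamj|_]; last first.
  by rewrite big_const_seq count_predT sD iter_addr_0.
have child_a c : c \in D -> agree (child y (L + j%:Z) c) a L.
  by move=> cD; apply: agree_trans ya; apply: agree_le (child_agree _ _ cD); lia.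
pose z c := dig (f (rank j) (child y (L + j%:Z) c)) == 0.
have -> : \sum_(c <- D) digit_weight (rank j) (child y (L + j%:Z) c) =
    \sum_(c <- D) (1 + e) - \sum_(c <- D) Q * e * (z c)%:R.
  rewrite -sumrB; apply: eq_bigr => c _; rewrite /digit_weight -/(z c) p0E p1E.
  by case: (z c); rewrite ?mulr1 ?mulr0; ring.
rewrite -mulr_sumr sum_count big_const_seq count_predT sD iter_addr_0.
rewrite -[(1 + e) *+ q]mulr_natr; have : (count z D)%:R <= 1 :> R; last first.
  move=> z1; have : Q * e * (count z D)%:R <= Q * e by rewrite ler_piMr ?mulr_ge0.
  by rewrite mulrDl mul1r (mulrC e); lra.
rewrite -[1]/(1%:R) ler_nat; apply: count_le1 => // c d cD dD /eqP zc /eqP zd.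
apply: (@child_inj y (L + j%:Z)) => //.
have cd : agree (child y (L + j%:Z) c) (child y (L + j%:Z) d) (L + j%:Z).
  by apply: agree_trans (child_agree _ _ cD) _; rewrite agree_sym child_agree.
have := @digit0_inj C hC hC0 (f (rank j) (child y (L + j%:Z) c))
  (f (rank j) (child y (L + j%:Z) d)).
rewrite zc zd !scaling_agree ?child_a// lamj add0r => /(_ cd erefl).
by rewrite [1 + _]addrC.
Qed.
End ScalingMaps.

(** Allowing any [A] that contains the points with non-uniform digits lets one bound serve both
    dimension claims. *)
Lemma hausdorff_dim_ge1 (C : seq F) (a : F) (r : R) (f : nat -> F -> F)
    (lam : nat -> int) (A : set F) :
  @rep_system R F v q C -> 0 \in C -> @complete_absv R F v q -> 0 < r ->
  (forall n, @scaling_on R F v q (@disk R F v q a r) (f n) (lam n)) ->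
  (forall n, lam n < lam n.+1) ->
  (forall x, @disk R F v q a r x ->
     ~ @ud_symbols R F q C (fun n => @digit0 R F v q C pi (f n x)) -> A x) ->
  (1%:E <= @hausdorff_dim R F v q A)%E.
Proof.
move=> hC hC0 cplt r0 hf hlam hA; apply: le_ereal_inf_tmp => _ [s [s0 As0] <-].
rewrite lee_fin leNgt; apply/negP => s1; move: As0.
(* [lam] grows by at least [1] per index, so after dropping the first [n0] maps the ball of level
   [lam n0] around [a] fits into the disk. *)
have [m mr] := absv_level r0; pose n0 := `|m%:Z - lam 0%N|%N.
have n0r : Q ^ (- lam n0) <= r.
  apply: le_trans mr; rewrite ler_eXz2l ?Q_gt1// lerN2.
  have := lam_ge hlam n0; rewrite /n0; lia.
have Qs : 1 < Q * Q `^ (- s).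
  rewrite -[X in X * _]powRr1 ?ler0n// -powRD ?Q_neq0 ?implybT//.
  by rewrite /powR (negbTE Q_neq0) expR_gt1 mulr_gt0 ?subr_gt0// ln_gt0// Q_gt1.
(* The first bound keeps [1 + e] within the weight limit of [hausdorff_measure_neq0]; the second
   keeps the weight of digit [0] positive. *)
pose e := Num.min (Q * Q `^ (- s) - 1) Q^-1.
have e0 : 0 < e by rewrite lt_min subr_gt0 Qs invr_gt0 Q_gt0.
have Qe : (Q - 1) * e < 1.
  apply: (@le_lt_trans _ _ ((Q - 1) * Q^-1)).
    by rewrite ler_pM2l ?subr_gt0 ?Q_gt1// ge_min lexx orbT.
  by rewrite mulrBl mulfV ?Q_neq0// gtrBl mul1r invr_gt0 Q_gt0.
have es : 1 + e <= Q * Q `^ (- s) by rewrite -lerBrDl ge_min lexx.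
have Qe0 : 0 <= (Q - 1) * e by rewrite mulr_ge0 ?ltW// subr_gt0 Q_gt1.
pose h := level_weight f lam n0 C (1 - (Q - 1) * e) (1 + e).
apply: (@hausdorff_measure_neq0 s (lam n0) a h) => //.
- move=> j x; rewrite /h /level_weight /digit_weight.
  by case: ifP => // _; case: ifP => _; lra.
- move=> j x; rewrite /h /level_weight /digit_weight.
  by case: ifP => _; [case: ifP => _|]; lra.
- exact: (weight_local hf _ _ hC hC0 n0r).
- by apply: (weight_sum hf hC hC0 n0r (ltW e0)).
move=> x xa prodh; apply: hA => [|ud]; first exact: le_trans xa n0r.
have := ud 0 hC0.
apply: (@biased_product_not_uniform _ Q e n0
  (fun n => @digit0 R F v q C pi (f n x) == 0)) => //.
  exact: Q_gt1.
by move=> M /(rank_surj hlam)[j <-]; rewrite -prod_rank; exact: prodh.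
Qed.
End Residues.
End Valuation.

Theorem theorem1p5 (R : realType) (F : fieldType) (v : F -> int) (q : nat)
  (hF : @nonarch_local_field R F v q)
  (pi : F) (hpi : pi != 0 /\ v pi = 1)
  (C : seq F) (hC : @rep_system R F v q C) (hC0 : 0 \in C)
  (a : F) (r : R) (hr : 0 < r)
  (f : nat -> F -> F) (lam : nat -> int)
  (hf : forall n, @scaling_on R F v q (@disk R F v q a r) (f n) (lam n))
  (hlam : forall n, lam n < lam n.+1) :
  @hausdorff_dim R F v q [set x | @disk R F v q a r x /\
      ~ @ud_symbols R F q C (fun n => @digit0 R F v q C pi (f n x))] = 1%:E /\
  @hausdorff_dim R F v q [set x | @disk R F v q a r x /\
      ~ @ud_O R F v q (fun n => @intpart R F v q C pi (f n x))] = 1%:E.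
Proof.
(* [D], duplicate-free of size [q], indexes the children of a ball, while [C] supplies the
   digits. *)
have [q_gt1 vP [D [hD [uD sD]]] cplt] := hF; have [pi0 vpi] := hpi.
have le1 A : A `<=` @disk R F v q a r -> (@hausdorff_dim R F v q A <= 1%:E)%E.
  by move=> Ar; apply: (hausdorff_dim_le1 q_gt1 vP pi0 vpi hD sD hr Ar).
split; apply: le_anti; apply/andP; split; try by apply: le1 => x [].
  apply: (hausdorff_dim_ge1 q_gt1 vP pi0 vpi hD sD uD hC hC0 cplt hr hf hlam).
  by move=> x xa nud.
apply: (hausdorff_dim_ge1 q_gt1 vP pi0 vpi hD sD uD hC hC0 cplt hr hf hlam).
move=> x xa nud; split=> // /(ud_O_symbols q_gt1 vP pi0 vpi hC hC0); exact: nud.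
Qed.
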